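(* Let $\epsilon\in(0,\frac12)$ and let $G$ be a layered graph over $\Sigma_{in}$ of depth $n\ge\frac{2}{1-\epsilon}$. Let $|\Sigma_{out}|>(2|\Sigma_{in}|)^{6/\epsilon^2}$. Then a uniformly random $(G,\Sigma_{out})$-code (each edge label chosen independently and uniformly from $\Sigma_{out}$) is an $\epsilon$-sensitive layered code on $G$ with alphabet $\Sigma_{out}$ with probability at least $1-2^{-n/4\epsilon}$.
   Context: A layered graph over alphabet $\Sigma$ of depth $n$ is a directed graph whose vertices are partitioned into layers $0,\dots,n$, with exactly one vertex (the root) in layer $0$, and each vertex in layer $i<n$ has exactly $|\Sigma|$ out-edges to layer $i+1$ labeled by the distinct elements of $\Sigma$ (endpoints need not be distinct). A string $p\in\Sigma_{in}^i$ determines a unique root path ending at vertex $v(p)$ in layer $i$. A $(G,\Sigma_{out})$-code $\mathsf{C}$ assigns an element of $\Sigma_{out}$ to each edge; $\mathsf{C}(p)$ is the label string along $p$. Suffix distance: $\Delta_{sfx}(x,y)=\max_{0\le i\le m-1}\frac{\Delta(x[i+1:m],y[i+1:m])}{m-i}$ for $x,y\in\Sigma^m$, $\Delta$ Hamming distance. $L_i(\mathsf{C},w,\epsilon)=\{v(p):p\in\Sigma_{in}^i,\ \Delta_{sfx}(\mathsf{C}(p),w[1:i])<1-\epsilon\}$, $L(\mathsf{C},w,\epsilon)=\bigcup_{i=1}^nL_i(\mathsf{C},w,\epsilon)$. For $S\subseteq L(\mathsf{C},w,\epsilon)$, a prefix tree of $S$ is a union of paths $p(v)$ ($v\in S$)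 from the root to $v$, each with $\Delta_{sfx}(\mathsf{C}(p(v)),w[1:|p(v)|])<1-\epsilon$, that forms a rooted tree; $\mathcal{PT}(\mathsf{C},w,\epsilon)$ is the set of all prefix trees of all subsets of $L(\mathsf{C},w,\epsilon)$. For a subgraph $H$, $w(H)$ labels each edge of $H$ at depth $i$ with $w[i]$, $\mathsf{C}(H)$ labels by $\mathsf{C}$, and $agr(\mathsf{C}(H),w(H))$ is the number of edges of $H$ with equal labels. A $(G,\Sigma_{out})$-code $\mathsf{C}$ is an $\epsilon$-sensitive layered code if for all $w\in\Sigma_{out}^n$ and all $PT\in\mathcal{PT}(\mathsf{C},w,\epsilon)$, $agr(\mathsf{C}(PT),w(PT))\le(1+\epsilon)n$. *)

(* Defs.v *)
From HB Require Import structures.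
From mathcomp Require Import all_boot all_order all_algebra.
From mathcomp Require Import boolp reals exp.
Set Implicit Arguments. Unset Strict Implicit. Unset Printing Implicit Defensive.
Import Order.TTheory GRing.Theory Num.Theory.
Local Open Scope ring_scope.

(* A layered graph of depth n over the alphabet Sin.  Vertices have a layer
   in 0..n; the root is the unique vertex of layer 0; every vertex v of layer
   < n has exactly |Sin| out-edges, namely the pairs (v,a), a : Sin, the edge
   (v,a) going to [lnext v a] in layer (lay v).+1 (endpoints need not be
   distinct). *)
Record layered_graph (Sin : finType) (n : nat) := LayeredGraph {
  lvert : finType;
  lay : lvert -> nat;
  lroot : lvert;
  lnext : lvert -> Sin -> lvert;
  lay_root : lay lroot = 0%N;
  root_unique : forall v, lay v = 0%N -> v = lroot;
  lay_le : forall v, (lay v <= n)%N;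
  lay_next : forall v a, (lay v < n)%N -> lay (lnext v a) = (lay v).+1
}.

Section LayeredCodes.
Variables (Sin Sout : finType) (n : nat) (G : layered_graph Sin n).

(* edges are pairs (v, a) with lay v < n *)
Definition ledge := (lvert G * Sin)%type.

(* a (G,Sout)-code: a label in Sout for each edge (values on pairs (v,a) with
   lay v = n are irrelevant) *)
Definition lcode := {ffun ledge -> Sout}.

Definition vend (p : seq Sin) : lvert G := foldl (@lnext _ _ G) (lroot G) p.

Fixpoint walk_edges (u : lvert G) (p : seq Sin) : seq ledge :=
  if p is a :: p' then (u, a) :: walk_edges (lnext u a) p' else [::].

Definition path_edges (p : seq Sin) : {set ledge} :=
  [set e in walk_edges (lroot G) p].

Definition code_word (C : lcode) (p : seq Sin) : seq Sout :=
  map C (walk_edges (lroot G) p).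

End LayeredCodes.

Definition hamming (T : eqType) (x y : seq T) : nat :=
  count (fun ab => ab.1 != ab.2) (zip x y).

Definition sfx_dist (R : realType) (T : eqType) (x y : seq T) : R :=
  \big[Num.max/0]_(i < size x)
     ((hamming (drop i x) (drop i y))%:R / (size x - i)%:R).

Section Sensitive.
Variables (R : realType) (Sin Sout : finType) (n : nat) (G : layered_graph Sin n).

Definition good_path (C : lcode Sout G) (w : n.-tuple Sout) (eps : R)
  (p : seq Sin) : Prop :=
  [/\ (1 <= size p <= n)%N &
      sfx_dist R (code_word C p) (take (size p) w) < 1 - eps].

Definition Lset (C : lcode Sout G) (w : n.-tuple Sout) (eps : R)
  : {set lvert G} :=
  [set v | [exists i : 'I_n.+1, exists p : i.-tuple Sin,
     (1 <= i)%N && (vend G p == v) &&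
     (sfx_dist R (code_word C p) (take i w) < 1 - eps)]].

Definition rooted_tree (H : {set ledge G}) : Prop :=
  forall u : lvert G,
    (u = lroot G \/ exists e, e \in H /\ (u = e.1 \/ u = lnext e.1 e.2)) ->
    exists! p : seq Sin, vend G p = u /\ {subset walk_edges (lroot G) p <= H}.

Definition prefix_tree (C : lcode Sout G) (w : n.-tuple Sout) (eps : R)
  (H : {set ledge G}) : Prop :=
  exists (S : {set lvert G}) (pv : lvert G -> seq Sin),
    [/\ S \subset Lset C w eps,
        (forall v, v \in S -> vend G (pv v) = v /\ good_path C w eps (pv v)),
        H = \bigcup_(v in S) path_edges G (pv v) &
        rooted_tree H].

(* agr(C(H), w(H)): number of edges of H (an edge (v,a) has depth lay v + 1
   and is labelled w[lay v + 1], i.e. the 0-indexed entry lay v of w) on which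
   the code label equals the w-label *)
Definition agr (C : lcode Sout G) (w : n.-tuple Sout) (H : {set ledge G}) : nat :=
  #|[set e in H | [exists i : 'I_n, (val i == lay e.1) && (C e == tnth w i)]]|.

Definition eps_sensitive (eps : R) (C : lcode Sout G) : Prop :=
  forall (w : n.-tuple Sout) (H : {set ledge G}),
    prefix_tree C w eps H -> (agr C w H)%:R <= (1 + eps) * n%:R.

End Sensitive.

(* Main.v *)
Require Import Defs.
From HB Require Import structures.
From mathcomp Require Import all_boot all_order all_algebra.
From mathcomp Require Import boolp reals exp.
From mathcomp Require Import ring lra.
Set Implicit Arguments. Unset Strict Implicit. Unset Printing Implicit Defensive.
Import Order.TTheory GRing.Theory Num.Theory.
Local Open Scope ring_scope.

(** If C is not sensitive, some word w and some prefix tree with edge set H,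
    |H| = m, agree on a set A of a > (1 + eps) n edges.  Adding the paths of
    the tree one at a time, each path contributes a suffix of itself, and
    suffixes of good paths agree with w on an eps-fraction of their edges;
    hence a >= eps m.  For fixed w and A a random code agrees with w on A with
    probability at most Q^-a, where Q = |Sout|.  Put N = 2 |Sin|.  The two
    lower bounds on a give Q^(n - a) <= N^(-n/eps) N^(-3m), so the union bound
    over w, H and A costs at most N^(-n/eps) times the sum over all trees of
    (2 N^-3)^m.  A recursion on the height bounds this generating function
    by 2. *)

(** * Elementary inequalities for sums and powers *)

Lemma sum_imset_le (R : realType) (I J : finType) (h : I -> J) (D : {set I})
    (F : J -> R) : (forall j, 0 <= F j) ->
  \sum_(j in h @: D) F j <= \sum_(i in D) F (h i).
Proof.
move=> F0; rewrite (partition_big_imset h) /=.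
apply: ler_sum => _ /imsetP[i iD ->].
rewrite (bigD1 i) /=; last by rewrite iD eqxx.
by rewrite lerDl; apply: sumr_ge0.
Qed.

Lemma expr1D_le2 (R : realType) (c : R) (q : nat) :
  0 <= c -> q%:R * c <= 1 / 2 -> (1 + c) ^+ q <= 2.
Proof.
move=> c0 qc.
(* This Bernoulli-type bound is inductive in [q], and [1 - q%:R * c] is at least 1/2. *)
suff: (1 + c) ^+ q * (1 - q%:R * c) <= 1.
  have : 0 <= (1 + c) ^+ q by apply: exprn_ge0; lra.
  by move: (_ ^+ _) => X; nra.
elim: q {qc} => [|q IH]; first by rewrite expr0 mul0r subr0 mulr1.
apply: le_trans IH; rewrite exprSr -natr1 -mulrA.
have : 0 <= (1 + c) ^+ q by apply: exprn_ge0; lra.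
move=> X0; rewrite ler_wpM2l //.
have : 0 <= q%:R * (c * c) by rewrite mulr_ge0 // mulr_ge0.
by move: (q%:R) => k; nra.
Qed.

(** * Generating function of trees of bounded height *)

Section Trees.
Variables (Sin : finType) (n : nat) (G : layered_graph Sin n).

Definition branches (e : ledge G) (T : {set {set ledge G}}) :
    {set {set ledge G}} :=
  set0 |: [set e |: H | H in T & e \notin H].

(** The cardinality condition encodes pairwise disjointness of the [f a], so that the weight
    [y ^+ #|_|] of the union is the product of the weights. *)
Definition forest (T : Sin -> {set {set ledge G}}) :
    {set {ffun Sin -> {set ledge G}}} :=
  [set f : {ffun Sin -> {set ledge G}} | [forall a, f a \in T a] &
           #|\bigcup_a f a| == \sum_a #|f a|].

(* Edge sets of the trees of height at most d grown from u in which distinct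
   branches use distinct edges; edges are never counted twice, so the
   cardinal of the edge set is the number of edges of the abstract tree. *)
Fixpoint trees (d : nat) (u : lvert G) : {set {set ledge G}} :=
  if d is d'.+1 then
    [set \bigcup_a (f : {ffun Sin -> {set ledge G}}) a
       | f in forest (fun a => branches (u, a) (trees d' (lnext u a)))]
  else [set set0].

Lemma sum_branches_le (R : realType) (y : R) (e : ledge G)
    (T : {set {set ledge G}}) : 0 <= y ->
  \sum_(H in T) y ^+ #|H| <= 2 ->
  \sum_(H in branches e T) y ^+ #|H| <= 1 + y * 2.
Proof.
move=> y0 le2; rewrite /branches big_setU1 /=; last first.
  by apply/imsetP => -[H _] /setP/(_ e); rewrite !inE eqxx.
rewrite cards0 expr0 lerD2l.
have := @sum_imset_le R _ _ (fun H => e |: H) [set H in T | e \notin H]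
          (fun H => y ^+ #|H|) (fun H => exprn_ge0 _ y0).
move=> /le_trans; apply.
apply: le_trans (ler_wpM2l y0 le2); rewrite mulr_sumr.
rewrite [leRHS](bigID (fun H : {set ledge G} => e \notin H)) /=.
rewrite -[leLHS]addr0; apply: lerD; last first.
  by apply: sumr_ge0 => H _; rewrite mulr_ge0 // exprn_ge0.
rewrite le_eqVlt; apply/orP; left; apply/eqP; apply: eq_big => [H|H].
  by rewrite !inE.
by rewrite inE => /andP[_ eH]; rewrite cardsU1 eH exprS.
Qed.

(** By induction on the height, each letter contributes a factor at most [1 + y * 2], and the
    product of [#|Sin|] such factors stays below 2. *)
Lemma sum_trees_le (R : realType) (y : R) d u : 0 <= y ->
  #|Sin|%:R * (y * 2) <= 1 / 2 -> \sum_(H in trees d u) y ^+ #|H| <= 2.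
Proof.
move=> y0 qy; elim: d u => [|d IH] u /=.
  by rewrite big_set1 cards0 expr0 ler1n.
set F := forest _.
apply: le_trans (sum_imset_le _ F _) _ => [H|]; first exact: exprn_ge0.
pose T a := branches (u, a) (trees d (lnext u a)).
apply: (@le_trans _ _ (\prod_a \sum_(H in T a) y ^+ #|H|)).
  (* The expanded product runs over all families of branches; the forests are the disjoint ones, and
     the other terms are nonnegative. *)
  rewrite bigA_distr_big_dep /=.
  rewrite [leRHS](bigID (fun f => f \in F)) /= -[leLHS]addr0.
  apply: lerD; last first.
    by apply: sumr_ge0 => f _; apply: prodr_ge0 => a _; apply: exprn_ge0.
  rewrite le_eqVlt; apply/orP; left; apply/eqP; apply: eq_big => f.
    rewrite [RHS]andbC; case: (boolP (f \in F)) => //=.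
    by rewrite inE => /andP[/forallP fT _]; apply/esym/familyP.
  by rewrite inE => /andP[_ /eqP ->]; rewrite -prodrXr.
apply: le_trans (expr1D_le2 _ qy); last by rewrite mulr_ge0.
rewrite -prodr_const; apply: ler_prod => a _.
rewrite sumr_ge0 => [|H _]; last exact: exprn_ge0.
exact: sum_branches_le.
Qed.

End Trees.

(** * Walks and rooted trees inside a layered graph *)

Section Walks.
Variables (Sin : finType) (n : nat) (G : layered_graph Sin n).
Implicit Types (u : lvert G) (p s : seq Sin) (H : {set ledge G}).

Lemma size_walk_edges u p : size (walk_edges u p) = size p.
Proof. by elim: p u => //= a p IH u; rewrite IH. Qed.

Lemma walk_edges_cat u p s :
  walk_edges u (p ++ s) =
  walk_edges u p ++ walk_edges (foldl (@lnext _ _ G) u p) s.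
Proof. by elim: p u => //= a p IH u; rewrite IH. Qed.

(** The hypothesis is there because [lnext] raises the layer only at vertices of layer below [n]. *)
Lemma lay_walk u p : {in walk_edges u p, forall e, lay e.1 < n}%N ->
  map (fun e => lay e.1) (walk_edges u p) = iota (lay u) (size p) /\
  lay (foldl (@lnext _ _ G) u p) = (lay u + size p)%N.
Proof.
elim: p u => [|a p IH] u /= lt_n; first by rewrite addn0.
have ltu : (lay u < n)%N by apply: (lt_n (u, a)); rewrite mem_head.
have [|-> ->] := IH (lnext u a).
  by move=> e ep; apply: lt_n; rewrite inE ep orbT.
by rewrite lay_next // addSnnS.
Qed.

Lemma walk_lay_lt u p : (lay u + size p <= n)%N ->
  {in walk_edges u p, forall e, lay e.1 < n}%N.
Proof.
elim: p u => [//|a p IH] u /= le_n e; rewrite inE => /predU1P[-> /=|].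
  by apply: leq_trans le_n; rewrite addnS ltnS leq_addr.
apply: IH; rewrite lay_next ?addSnnS //.
by apply: leq_trans le_n; rewrite addnS ltnS leq_addr.
Qed.

Lemma rooted_tree_path H : rooted_tree H -> exists r : lvert G -> seq Sin,
  forall e, e \in H ->
  [/\ vend G (r e.1) = e.1, {subset walk_edges (lroot G) (r e.1) <= H} &
      forall p, vend G p = e.1 -> {subset walk_edges (lroot G) p <= H} ->
                p = r e.1].
Proof.
move=> Htree.
have /choice[r rP] : forall u, exists p : seq Sin,
    (exists e, e \in H /\ u = e.1) ->
    [/\ vend G p = u, {subset walk_edges (lroot G) p <= H} &
      forall p', vend G p' = u -> {subset walk_edges (lroot G) p' <= H} ->
                p' = p].
  move=> u; have [[e [eH ue]]|noe] := pselect (exists e, e \in H /\ u = e.1).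
    have [|p [[pu pH] puniq]] := Htree u.
      by right; exists e; split=> //; left.
    by exists p => _; split=> // p' p'u p'H; apply/esym/puniq.
  by exists [::].
by exists r => e eH; apply: rP; exists e.
Qed.

(** Unique root paths identify subtrees with prefixes: [above p] collects the edges whose tail is
    reached through [p], and induction on the remaining height [d] splits it by the letter after
    [p]. *)
Lemma rooted_tree_in_trees H : (forall e, e \in H -> lay e.1 < n)%N ->
  rooted_tree H -> H \in trees n (lroot G).
Proof.
move=> Hlay /rooted_tree_path[r rP].
pose above p := [set e in H | prefix p (r e.1)].
suff above_trees d p : {subset walk_edges (lroot G) p <= H} ->
    (n <= size p + d)%N -> above p \in trees d (vend G p).
  have -> : H = above [::] by apply/setP => e; rewrite inE prefix0s andbT.
  by apply: above_trees.
elim: d p => [|d IH] p pH lenp.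
  rewrite /= inE; apply/eqP/setP => e; rewrite !inE.
  apply/negP => /andP[eH /size_prefix lepr].
  have [re rH _] := rP _ eH.
  have [|_] := @lay_walk (lroot G) (r e.1).
    by move=> e' /rH; apply: Hlay.
  rewrite -/(vend G _) re lay_root add0n => layE.
  have := Hlay _ eH; rewrite layE ltnNge => /negP; apply.
  by apply: leq_trans lepr; rewrite -(addn0 (size p)).
pose u := vend G p.
(* The default [e.2] matters: when the path to the tail of [e] is exactly [p], the next letter is
   the label of [e] itself. *)
pose f : {ffun Sin -> {set ledge G}} :=
  [ffun a => [set e in above p | nth e.2 (r e.1) (size p) == a]].
have aboveE : above p = \bigcup_a f a.
  apply/setP => e; apply/idP/bigcupP => [ep|[a _]]; last first.
    by rewrite ffunE inE => /andP[].
  by exists (nth e.2 (r e.1) (size p)) => //; rewrite ffunE inE ep eqxx.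
have fE a : f a = if (u, a) \in H then (u, a) |: above (rcons p a) else set0.
  apply/setP => e; rewrite ffunE !inE; apply/idP/idP.
    move=> /andP[/andP[eH /prefixP[s rE]] /eqP ka].
    have [re rH _] := rP _ eH.
    case: s rE => [|b s] rE.
      rewrite cats0 in rE.
      have eE : e = (u, a).
        rewrite rE nth_default // in ka.
        by rewrite -ka /u -rE re -surjective_pairing.
      by rewrite -eE eH !inE eqxx.
    move: ka; rewrite rE nth_cat ltnn subnn /= => ba; rewrite {b}ba in rE.
    have -> : (u, a) \in H.
      by apply: rH; rewrite rE walk_edges_cat mem_cat /= mem_head orbT.
    by rewrite !inE eH rE -cat_rcons prefix_prefix orbT.
  case: ifP => [uaH|]; last by rewrite inE.
  rewrite !inE => /predU1P[->|/andP[eH /prefixP[s rE]]].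
    have [_ _ /(_ p erefl pH) <-] := rP _ uaH.
    by rewrite uaH prefix_refl nth_default /=.
  rewrite eH rE cat_rcons prefix_prefix nth_cat ltnn subnn /=.
  by rewrite eqxx.
apply/imsetP; exists f => //; rewrite inE; apply/andP; split.
  apply/forallP => a; rewrite fE inE; case: ifP => uaH; last by rewrite inE eqxx.
  apply/orP; right; apply/imsetP; exists (above (rcons p a)) => //.
  rewrite inE; apply/andP; split.
    have -> : lnext u a = vend G (rcons p a) by rewrite /vend -cats1 foldl_cat.
    apply: IH; last by rewrite size_rcons addSnnS.
    move=> e; rewrite -cats1 walk_edges_cat mem_cat => /orP[/pH //|].
    by rewrite inE => /eqP ->.
  rewrite inE uaH /=; have [_ _ /(_ p erefl pH) <-] := rP _ uaH.
  by apply/negP => /size_prefix; rewrite size_rcons ltnn.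
rewrite -aboveE -sum1_card
  (partition_big (fun e => nth e.2 (r e.1) (size p)) predT) //=.
apply/eqP/eq_bigr => a _; rewrite ffunE -sum1_card.
by apply: eq_bigl => e; rewrite !inE.
Qed.

End Walks.

(** * Agreement with a word along paths and trees *)

Section Agreement.
Variables (R : realType) (Sin Sout : finType) (n : nat).
Variable G : layered_graph Sin n.
Implicit Types (C : lcode Sout G) (w : n.-tuple Sout) (H A : {set ledge G}).

Definition agrees C w (e : ledge G) :=
  [exists i : 'I_n, (val i == lay e.1) && (C e == tnth w i)].

Lemma agreesE C w c0 (e : ledge G) : (lay e.1 < n)%N ->
  agrees C w e = (C e == nth c0 w (lay e.1)).
Proof.
move=> lt_n; apply/existsP/idP => [[i /andP[/eqP <- /eqP ->]]|/eqP CE].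
  by rewrite (tnth_nth c0).
by exists (Ordinal lt_n); rewrite /= eqxx CE (tnth_nth c0) eqxx.
Qed.

Lemma hamming_drop_walk C w p i : (size p <= n)%N ->
  hamming (drop i (code_word C p)) (drop i (take (size p) w)) =
  count (predC (agrees C w)) (drop i (walk_edges (lroot G) p)).
Proof.
move=> le_n; set W := walk_edges _ _.
have Wlt : {in W, forall e, lay e.1 < n}%N.
  by apply: walk_lay_lt; rewrite lay_root.
(* The first edge [e0] provides the default label [C e0] for [nth]; an empty walk has none. *)
case EW : W => [|e0 W'].
  have := size_walk_edges (lroot G) p; rewrite /code_word -/W EW => <-.
  by rewrite take0.
rewrite -EW; pose g (e : ledge G) := nth (C e0) w (lay e.1).
have -> : take (size p) w = map g W.
  rewrite (map_comp (nth (C e0) w) (fun e : ledge G => lay e.1)).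
  have [-> _] := lay_walk Wlt.
  by rewrite lay_root map_nth_iota0 // size_tuple.
rewrite /code_word -/W -!map_drop /hamming zip_map count_map.
apply: eq_in_count => e /mem_drop eW /=.
by rewrite (@agreesE _ _ (C e0)) ?Wlt.
Qed.

(** The suffix distance bounds the disagreements on each nonempty suffix by a fraction [1 - eps] of
    its length; the remaining edges agree. *)
Lemma good_path_suffix C w (eps : R) p i : good_path C w eps p ->
  eps * (size p - i)%:R <=
    (count (agrees C w) (drop i (walk_edges (lroot G) p)))%:R.
Proof.
move=> [/andP[_ le_n]]; have [le_i _|lt_i] := leqP (size p) i.
  by rewrite (eqP le_i) mulr0.
have szC : size (code_word C p) = size p by rewrite size_map size_walk_edges.
move=> lt_eps.
have lt_iC : (i < size (code_word C p))%N by rewrite szC.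
have := le_lt_trans (le_bigmax _ _ (Ordinal lt_iC)) lt_eps.
rewrite /= hamming_drop_walk // szC.
have k0 : 0 < (size p - i)%:R :> R by rewrite ltr0n subn_gt0.
rewrite ltr_pdivrMr // => lt_h.
have /(congr1 (GRing.natmul (1 : R))) :=
  count_predC (agrees C w) (drop i (walk_edges (lroot G) p)).
rewrite natrD size_drop size_walk_edges; lra.
Qed.

(* Along a prefix tree the paths can be added one at a time, the edges that a
   path adds form one of its suffixes, and every suffix of a good path agrees
   with w on an eps-fraction of its edges. *)
Lemma prefix_tree_density C w (eps : R) H : prefix_tree C w eps H ->
  eps * #|H|%:R <= (agr C w H)%:R.
Proof.
move=> [S [pv [_ pvP HE /rooted_tree_path[r rP]]]].
pose U (s : seq (lvert G)) := \bigcup_(v <- s) path_edges G (pv v).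
have UE s e : e \in U s ->
    exists2 v, v \in s & e \in walk_edges (lroot G) (pv v).
  rewrite /U; elim: s => [|v s IH]; first by rewrite big_nil inE.
  rewrite big_cons !inE => /orP[ev|/IH[v' v's ev']].
    by exists v => //; rewrite mem_head.
  by exists v' => //; rewrite inE v's orbT.
have subU s v e : v \in s -> e \in walk_edges (lroot G) (pv v) -> e \in U s.
  rewrite /U; elim: s => [//|v' s IH].
  rewrite big_cons !inE => /predU1P[->->//|vs ev].
  by rewrite IH // orbT.
have pvH v : v \in S -> {subset walk_edges (lroot G) (pv v) <= H}.
  by move=> vS e ev; rewrite HE; apply/bigcupP; exists v; rewrite // inE.
(* By uniqueness of root paths, the part of [pv v] before [e] does not depend on [v]: paths sharing
   an edge share everything before it. *)
have split_walk v e : v \in S -> e \in walk_edges (lroot G) (pv v) ->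
    exists rest, walk_edges (lroot G) (pv v) =
                 rcons (walk_edges (lroot G) (r e.1)) e ++ rest.
  move=> vS ev; have eH := pvH _ vS _ ev.
  have splitP u p : e \in walk_edges u p -> exists s a t,
      p = s ++ a :: t /\ e = (foldl (@lnext _ _ G) u s, a).
    elim: p u => [//|a p IH] u /=; rewrite inE => /predU1P[->|/IH].
      by exists [::], a, p.
    by move=> [s [b [t [-> ->]]]]; exists (a :: s), b, t.
  have [s [a [t [pE eE]]]] := splitP _ _ ev.
  have [_ _ /(_ s) rE] := rP _ eH.
  exists (walk_edges (lnext (vend G s) a) t).
  rewrite -rE; last 2 first.
  - by rewrite eE.
  - move=> e' e's; apply: (pvH v) => //.
    by rewrite pE walk_edges_cat mem_cat e's.
  by rewrite cat_rcons pE walk_edges_cat /= -/(vend G s) -[(_, a)]eE.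
suff main s : {subset s <= S} ->
    eps * #|U s|%:R <= #|[set e in U s | agrees C w e]|%:R.
  have -> : H = U (enum S) by rewrite HE /U big_enum.
  by apply: main => v; rewrite mem_enum.
elim: s => [|v s IH] sS.
  by rewrite /U big_nil cards0 mulr0.
have vS : v \in S by apply: sS; rewrite mem_head.
have {}sS : {subset s <= S} by move=> v' v's; apply: sS; rewrite inE v's orbT.
have {IH} IH := IH sS.
have [_ good] := pvP _ vS.
pose W := walk_edges (lroot G) (pv v).
have Wuniq : uniq W.
  have [/andP[_ le_n] _] := good.
  apply: (@map_uniq _ _ (fun e => lay e.1)).
  have [|-> _] := @lay_walk _ _ G (lroot G) (pv v).
    by apply: walk_lay_lt; rewrite lay_root.
  exact: iota_uniq.
(* The new path leaves the tree built so far at position [i]; [D] is the suffix that it adds. *)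
pose i := find (fun e => e \notin U s) W.
pose D := drop i W.
(* If [e] were already in [U s], so would be the whole initial part of [W] through [e]; then [i]
   lies beyond it and [e] occurs twice in [W]. *)
have DU e : e \in D -> e \notin U s.
  move=> eD; apply/negP => eU.
  have [v' v's ev'] := UE _ _ eU.
  have [rest' E'] := split_walk _ _ (sS _ v's) ev'.
  have [rest E] := split_walk _ _ vS (mem_drop eD).
  move: eD Wuniq; rewrite /D /i /W E find_cat ifF; last first.
    apply/negbTE/hasPn => e0 e0in; rewrite negbK.
    by apply: (subU _ v') => //; rewrite E' mem_cat e0in.
  rewrite drop_cat ltnNge leq_addr /= addKn => /mem_drop erest.
  rewrite cat_uniq => /and3P[_ /hasPn/(_ _ erest) + _].
  by rewrite mem_rcons mem_head.
have UvE : U (v :: s) = [set e in D] :|: U s.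
  rewrite /U big_cons -/(U s) /path_edges -/W; apply/setP => e; rewrite !inE.
  rewrite -[in LHS](cat_take_drop i W) mem_cat -/D -orbA.
  case: (boolP (e \in take i W)) => //= etake.
  have : ~~ has (fun e => e \notin U s) (take i W).
    by rewrite has_take_leq ?ltnn ?find_size.
  by move=> /hasPn/(_ _ etake); rewrite negbK => ->; rewrite orbT.
have Duniq : uniq D by rewrite drop_uniq.
have agrE : [set e in U (v :: s) | agrees C w e] =
    [set e in filter (agrees C w) D] :|: [set e in U s | agrees C w e].
  by rewrite UvE; apply/setP => e; rewrite !inE mem_filter andb_orl [in RHS]andbC.
have cardD (D' : seq (ledge G)) : uniq D' -> #|[set e in D']| = size D'.
  by move=> uD'; rewrite cardsE; apply/card_uniqP.
have -> : #|[set e in U (v :: s) | agrees C w e]| =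
    (count (agrees C w) D + #|[set e in U s | agrees C w e]|)%N.
  rewrite agrE cardsU cardD ?filter_uniq // size_filter.
  rewrite (_ : _ :&: _ = set0) ?cards0 ?subn0 //.
  apply/setP => e; rewrite !inE mem_filter; apply/negP.
  by move=> /andP[/andP[_ /DU/negP eU] /andP[/eU]].
have -> : #|U (v :: s)| = (size (pv v) - i + #|U s|)%N.
  rewrite UvE cardsU cardD // size_drop size_walk_edges.
  rewrite (_ : _ :&: _ = set0) ?cards0 ?subn0 //.
  by apply/setP => e; rewrite !inE; apply/negP => /andP[/DU/negP].
by rewrite !natrD mulrDr lerD // good_path_suffix.
Qed.

Lemma prefix_tree_in_trees C w (eps : R) H :
  prefix_tree C w eps H -> H \in trees n (lroot G).
Proof.
move=> [S [pv [_ pvP HE Htree]]]; apply: rooted_tree_in_trees => // e.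
rewrite HE => /bigcupP[v /pvP[_ [/andP[_ le_n] _]]].
by rewrite inE; apply: walk_lay_lt; rewrite lay_root.
Qed.

(** Labels are chosen edge by edge, and on an edge of [A] at most one label is allowed, the entry of
    [w] at its layer. *)
Lemma card_agreeing_codes w A :
  (#|[set C : lcode Sout G | [forall e in A, agrees C w e]]| * #|Sout| ^ #|A|
    <= #|{: lcode Sout G}|)%N.
Proof.
pose F (e : ledge G) := [pred c | (e \in A) ==>
  [exists i : 'I_n, (val i == lay e.1) && (c == tnth w i)]].
have sub : [set C : lcode Sout G | [forall e in A, agrees C w e]]
    \subset family F.
  by apply/subsetP => C; rewrite inE => /forallP CA; apply/familyP.
apply: leq_trans (leq_mul (subset_leq_card sub) (leqnn _)) _.
have -> : (#|Sout| ^ #|A| = \prod_e if e \in A then #|Sout| else 1)%N.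
  by rewrite -big_mkcond prod_nat_const.
rewrite card_family foldrE big_map big_enum /= -big_split /=.
rewrite card_ffun -prod_nat_const /=.
apply: leq_prod => e _; rewrite /F; case: (boolP (e \in A)) => eA; last first.
  by rewrite muln1; apply: max_card.
rewrite -[leqRHS]mul1n leq_mul2r; apply/orP; right.
apply/card_le1_eqP => c c'; rewrite !unfold_in /=.
move=> /existsP[i /andP[/eqP iE /eqP ->]] /existsP[j /andP[/eqP jE /eqP ->]].
by congr tnth; apply: val_inj; rewrite /= iE jE.
Qed.

End Agreement.

(** * Union bound and comparison of exponents *)

Lemma card_bigcup_le (R : realType) (I T : finType) (P : pred I)
    (F : I -> {set T}) (b : I -> R) :
  (forall i, P i -> #|F i|%:R <= b i) ->
  #|\bigcup_(i | P i) F i|%:R <= \sum_(i | P i) b i.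
Proof.
move=> Fb; elim/big_rec2: _ => [|i x A Pi Ax]; first by rewrite cards0.
apply: le_trans (lerD (Fb i Pi) Ax).
by rewrite -natrD ler_nat leq_card_setU.
Qed.

Lemma alphabet_power_le (R : realType) (eps : R) (q Q n m a : nat) :
  0 < eps -> eps < 1 / 2 -> (0 < q)%N ->
  (2 * q)%:R `^ (6 / eps ^+ 2) < Q%:R ->
  (1 + eps) * n%:R <= a%:R -> eps * m%:R <= a%:R ->
  Q%:R ^+ n / Q%:R ^+ a <=
    (2 * q)%:R `^ (- (n%:R / eps)) * (((2 * q)%:R ^- 3) ^+ m) :> R.
Proof.
move=> eps0 eps12 q0 ltQ lena lema; set N : R := (2 * q)%:R.
have N1 : 1 <= N by rewrite ler1n muln_gt0.
have N0 : 0 < N by lra.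
have Q0 : 0 < Q%:R :> R by apply: le_lt_trans (powR_ge0 _ _) ltQ.
have n0 : 0 <= n%:R :> R by [].
have m0 : 0 <= m%:R :> R by [].
have le_na : (n <= a)%N by rewrite -(ler_nat R); nra.
have anE : (a - n)%:R = a%:R - n%:R :> R by rewrite natrB.
have -> : Q%:R ^+ n / Q%:R ^+ a = Q%:R ^- (a - n) :> R.
  rewrite -{1}(subnK le_na) exprD invfM mulrCA mulfV ?mulr1 //.
  by rewrite expf_neq0 // gt_eqF.
rewrite powRN exprVn -exprM -invfM.
rewrite lef_pV2 ?posrE ?mulr_gt0 ?exprn_gt0 ?powR_gt0 //.
rewrite -(powR_mulrn (3 * m) (ltW N0)) -powRD; last first.
  by rewrite (gt_eqF N0) implybT.
apply: (@le_trans _ _ ((N `^ (6 / eps ^+ 2)) ^+ (a - n))); last first.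
  by apply: lerXn2r; rewrite ?nnegrE ?powR_ge0 ?ltW.
rewrite -powR_mulrn ?powR_ge0 // -powRrM; apply: ler_powR => //.
rewrite anE natrM.
(* With x = a - n, the bounds [h1] and [h2] make the left side at most (1 + 3 (1 + eps)) x, and eps
   < 1/2 brings this below 6 x: hence the 6 in the alphabet size. *)
have key : eps * n%:R + 3 * (eps ^+ 2 * m%:R) <= 6 * (a%:R - n%:R).
  have h1 : eps * n%:R <= a%:R - n%:R by lra.
  have h2 : eps ^+ 2 * m%:R <= (1 + eps) * (a%:R - n%:R).
    have : eps * (eps * m%:R) <= eps * a%:R by rewrite ler_wpM2l // ltW.
    rewrite expr2; nra.
  have h3 : 0 <= a%:R - n%:R :> R by apply: le_trans h1; rewrite mulr_ge0 // ltW.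
  move: h1 h2 h3; move: (a%:R - n%:R) (eps ^+ 2 * _) => x z.
  nra.
have e2 : 0 < eps ^+ 2 by rewrite exprn_gt0.
have -> : n%:R / eps + 3%:R * m%:R =
          (eps * n%:R + 3 * (eps ^+ 2 * m%:R)) / eps ^+ 2.
  by field; rewrite gt_eqF.
by rewrite [leRHS]mulrAC ler_pM2r ?invr_gt0.
Qed.

(* Probability over a uniformly random code = fraction of all codes. *)
Theorem theorem5p7 (R : realType) (Sin Sout : finType) (n : nat)
  (G : layered_graph Sin n) (eps : R) :
  0 < eps -> eps < 1 / 2 ->
  2 / (1 - eps) <= n%:R ->
  (2 * #|Sin|)%:R `^ (6 / eps ^+ 2) < #|Sout|%:R ->
  1 - 2 `^ (- (n%:R / (4 * eps))) <=
    #|[set C : lcode Sout G | `[< eps_sensitive eps C >] ]|%:R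
      / #|{: lcode Sout G}|%:R.
Proof.
move=> eps0 eps12 le_n ltQ.
set good := [set C | _]; set T : R := #|{: lcode Sout G}|%:R.
have n1 : 1 <= n%:R :> R.
  by apply: le_trans le_n; rewrite ler_pdivlMr; lra.
have Q0 : 0 < #|Sout|%:R :> R by apply: le_lt_trans (powR_ge0 _ _) ltQ.
have T0 : 0 < T.
  by rewrite /T card_ffun ltr0n expn_gt0 -(ltr0n R) Q0.
pose bad := ~: good.
suff bad_le : #|bad|%:R <= T * 2 `^ (- (n%:R / (4 * eps))).
  rewrite ler_pdivlMr // mulrBl mul1r lerBlDr.
  rewrite /T -(cardsC good) natrD lerD2l -natrD cardsC -/T.
  by rewrite mulrC.
(* Without input letters there are no edges, hence no bad codes; otherwise the base [N] below is at
   least 2. *)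
have [q0|q0] := posnP #|Sin|.
  have -> : bad = set0.
    apply/setP => C; rewrite !inE; apply/negbTE; rewrite negbK.
    apply/asboolP => w H _.
    have -> : agr C w H = 0%N.
      apply/eqP; rewrite cards_eq0; apply/eqP/setP => -[v a].
      by have := fintype0 a q0.
    by rewrite mulr_ge0 // addr_ge0 ?ltW.
  by rewrite cards0 mulr_ge0 ?ltW ?powR_gt0.
set N : R := (2 * #|Sin|)%:R in ltQ.
have q1 : 1 <= #|Sin|%:R :> R by rewrite ler1n.
have NE : N = 2 * #|Sin|%:R by rewrite /N natrM.
have N2 : 2 <= N by lra.
have N0 : 0 < N by lra.
pose K : R := N `^ (- (n%:R / eps)).
have K0 : 0 <= K by exact: powR_ge0.
(* The 2 pays for choosing [A] inside [H]. The cube gives [qy]: as [#|Sin|] is N/2, its left side is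
   2/N^2, at most 1/2. *)
pose y : R := 2 * N ^- 3.
have y0 : 0 <= y by rewrite mulr_ge0 // invr_ge0 exprn_ge0 //; lra.
have qy : #|Sin|%:R * (y * 2) <= 1 / 2.
  have -> : #|Sin|%:R * (y * 2) = 2 / N ^+ 2.
    rewrite /y; have -> : #|Sin|%:R = N / 2 by rewrite NE; field.
    by field; rewrite gt_eqF //; lra.
  by rewrite ler_pdivrMr ?exprn_gt0 // ?expr2; nra.
pose large (H A : {set ledge G}) :=
  ((1 + eps) * n%:R <= #|A|%:R) && (eps * #|H|%:R <= #|A|%:R).
pose match_ (w : n.-tuple Sout) (A : {set ledge G}) :=
  [set C : lcode Sout G | [forall e in A, agrees C w e]].
have bad_sub : bad \subset \bigcup_w \bigcup_(H in trees n (lroot G))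
    \bigcup_(A in powerset H | large H A) match_ w A.
  apply/subsetP => C; rewrite !inE => /asboolPn/existsNP[w].
  move=> /existsNP[H] /not_implyP[HT /negP]; rewrite -ltNge => lt_agr.
  apply/bigcupP; exists w => //; apply/bigcupP; exists H.
    exact: prefix_tree_in_trees HT.
  apply/bigcupP; exists [set e in H | agrees C w e].
    rewrite powersetE; apply/andP; split.
      by apply/subsetP => e; rewrite inE => /andP[].
    by rewrite /large ltW //=; exact: prefix_tree_density HT.
  by rewrite inE; apply/forallP => e; rewrite inE; apply/implyP => /andP[].
have Qn0 : 0 < #|Sout|%:R ^+ n :> R by rewrite exprn_gt0.
(* The division by [#|Sout|%:R ^+ n] is undone by the sum over all words [w]. *)
pose Z : R := T * K / #|Sout|%:R ^+ n.
have Z0 : 0 <= Z by rewrite /Z divr_ge0 ?mulr_ge0 //; apply: ltW.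
have match_le w H A : large H A -> #|match_ w A|%:R <= Z * (N ^- 3) ^+ #|H|.
  move=> /andP[large1 large2].
  have Qa0 : 0 < #|Sout|%:R ^+ #|A| :> R by rewrite exprn_gt0.
  have := card_agreeing_codes w A; rewrite -(ler_nat R) natrM natrX -/T.
  rewrite -ler_pdivlMr // => /le_trans; apply.
  have weight_le : #|Sout|%:R ^+ n / #|Sout|%:R ^+ #|A| <= K * (N ^- 3) ^+ #|H|.
    exact: alphabet_power_le eps0 eps12 q0 ltQ large1 large2.
  rewrite /Z (mulrAC (T * K)) ler_pdivlMr // mulrAC -!mulrA.
  by rewrite (ler_wpM2l (ltW T0)).
have bad_le : #|bad|%:R <= T * (2 * K).
  apply: (@le_trans _ _ (\sum_(w : n.-tuple Sout) Z * 2)); last first.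
    rewrite sumr_const card_tuple -[_ *+ (_ ^ _)]mulr_natr natrX /Z.
    by rewrite le_eqVlt; apply/orP; left; apply/eqP; field; rewrite gt_eqF.
  have := subset_leq_card bad_sub; rewrite -(ler_nat R) => /le_trans; apply.
  apply: card_bigcup_le => w _.
  apply: le_trans (ler_wpM2l Z0 (sum_trees_le n (lroot G) y0 qy)).
  rewrite mulr_sumr; apply: card_bigcup_le => H _.
  pose t := Z * (N ^- 3) ^+ #|H|.
  have t0 : 0 <= t.
    by rewrite mulr_ge0 // exprn_ge0 // invr_ge0 exprn_ge0 //; lra.
  apply: (@le_trans _ _ (\sum_(A in powerset H | large H A) t)).
    by apply: card_bigcup_le => A /andP[_ lHA]; apply: match_le.
  apply: (@le_trans _ _ (\sum_(A in powerset H) t)).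
    by rewrite [leRHS](bigID (large H)) /= lerDl; apply: sumr_ge0.
  rewrite sumr_const card_powerset -[_ *+ (_ ^ _)]mulr_natr natrX /y exprMn.
  by rewrite -mulrA [_ * 2 ^+ _]mulrC.
apply: le_trans bad_le _; rewrite (ler_wpM2l (ltW T0)) //.
have -> : 2 * K = 2 `^ 1 * K by rewrite powRr1.
apply: (@le_trans _ _ (2 `^ 1 * 2 `^ (- (n%:R / eps)))).
  rewrite ler_wpM2l ?powR_ge0 // /K !powRN lef_pV2 ?posrE ?powR_gt0 //.
  by apply: ge0_ler_powR; rewrite ?nnegrE ?divr_ge0 // ltW.
rewrite -powRD ?pnatr_eq0 ?implybT //; apply: ler_powR; first lra.
(* With t = n/eps at least 2, the leading factor 2 is absorbed: 1 - t <= -t/4. *)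
have : 2 <= n%:R / eps by rewrite ler_pdivlMr //; lra.
have -> : n%:R / (4 * eps) = n%:R / eps / 4 by field; rewrite gt_eqF.
lra.
Qed.
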